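(* Let $k$ be a field, let $n\geq 3$ and $t\geq 1$ be integers, and let $R=k[x_1,\ldots,x_n]$. Then the ideal $$K_n^{(t)}=\bigcap_{1\leq i<j\leq n}\langle x_i,x_j\rangle^{t}\subset R$$ (the intersection being over all edges $\{x_i,x_j\}$ of the complete graph on the vertices $x_1,\ldots,x_n$) is componentwise linear.
   Context: $R=k[x_1,\ldots,x_n]$ is the polynomial ring with its standard grading ($\deg x_i=1$). For a graded ideal $I\subset R$ and an integer $d$, $I_{\langle d\rangle}$ denotes the ideal generated by the elements of degree $d$ that belong to $I$. A graded ideal $I\subset R$ is called componentwise linear if $I_{\langle d\rangle}$ has a linear resolution for all $d$. Here a graded ideal $J$ generated in degree $d$ has a linear resolution if $\operatorname{Tor}_i^R(J,k)_{i+j}=0$ for all $i\geq 0$ and all $j\neq d$ (equivalently, in the minimal graded free resolution of $J$ the $i$-th free module is generated in degree $d+i$ for all $i$); the zero ideal satisfies this trivially. *)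

(* Defs.v *)
From mathcomp Require Import all_boot all_order all_algebra.
From mathcomp.multinomials Require Import mpoly.

Set Implicit Arguments.
Unset Strict Implicit.
Unset Printing Implicit Defensive.

Import GRing.Theory.
Local Open Scope ring_scope.

(* Ideals are Prop-valued subsets: the ideals of ring_quotient.v are boolean
   and required to be proper. *)
Section Ideals.
Variable A : comNzRingType.
Implicit Types (S I J : A -> Prop) (f g : A).

Definition is_ideal I : Prop :=
  [/\ I 0, forall f g, I f -> I g -> I (f + g) & forall f g, I g -> I (f * g)].

Definition ideal_gen S : A -> Prop := fun f =>
  exists (m : nat) (c g : 'I_m -> A),
    (forall i, S (g i)) /\ f = \sum_(i < m) c i * g i.

Definition ideal_mul I J : A -> Prop :=
  ideal_gen (fun h => exists f g, [/\ I f, J g & h = f * g]).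

Fixpoint ideal_pow I (t : nat) : A -> Prop :=
  if t is t'.+1 then ideal_mul I (ideal_pow I t') else fun=> True.

End Ideals.

Section Graded.
Variables (k : fieldType) (n : nat).
Local Notation R := {mpoly k[n]}.
Implicit Types (I J : R -> Prop).

Definition graded_ideal I : Prop :=
  is_ideal I /\ forall f d, I f -> I (pihomog mdeg d f).

Definition degree_component_ideal I (d : nat) : R -> Prop :=
  ideal_gen (fun f => I f /\ f \is d.-homog).

(* Elements of a free module are row vectors and maps act on the right:
   F_i = (+)_a R(- gdeg i a) has its a-th basis vector in degree gdeg i a,
   diff i : F_{i+1} -> F_i, and aug : F_0 -> R. *)
Record augmented_complex := AugmentedComplex {
  rk : nat -> nat;
  gdeg : forall i, 'I_(rk i) -> int;
  diff : forall i, 'M[R]_(rk i.+1, rk i);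
  aug : 'cV[R]_(rk 0)
}.

Definition homog_of_deg (e : int) (f : R) : Prop :=
  forall m, m \in msupp f -> (mdeg m)%:Z = e.

Definition graded_free_resolution (F : augmented_complex) J : Prop :=
  [/\ forall i a b,
        homog_of_deg (gdeg a - gdeg b) (diff F i a b),
      forall a, homog_of_deg (gdeg a) (aug F a 0),
      forall f, J f <-> exists v : 'rV_(rk F 0), (v *m aug F) 0 0 = f,
      forall v : 'rV_(rk F 0),
        v *m aug F = 0 <-> exists w : 'rV_(rk F 1), v = w *m diff F 0
    & forall i (v : 'rV_(rk F i.+1)),
        v *m diff F i = 0 <-> exists w : 'rV_(rk F i.+2), v = w *m diff F i.+1].

(* The complex F (x)_R k, with k = R / (x_1, ..., x_n): its i-th term is
   k^(rk F i), and its maps are the constant terms of those of F. *)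
Definition tdiff (F : augmented_complex) i : 'M[k]_(rk F i.+1, rk F i) :=
  map_mx (fun f : R => f@_0%MM) (diff F i).

Definition in_degree (F : augmented_complex) i (e : int) (v : 'rV[k]_(rk F i)) :
    Prop :=
  forall a, gdeg a != e -> v 0 a = 0.

Definition tcycle (F : augmented_complex) i : 'rV[k]_(rk F i) -> Prop :=
  if i is i'.+1 then fun v => v *m tdiff F i' = 0 else fun=> True.

Definition tboundary (F : augmented_complex) i (v : 'rV[k]_(rk F i)) : Prop :=
  exists w : 'rV_(rk F i.+1), v = w *m tdiff F i.

(* Tor_i^R(J, k)_e = 0. Tor does not depend on the graded free resolution of J
   used to compute it, and such a resolution exists for every graded J. *)
Definition tor_vanishes J (i : nat) (e : int) : Prop :=
  exists2 F : augmented_complex, graded_free_resolution F J &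
    forall v : 'rV_(rk F i), in_degree e v -> tcycle v -> tboundary v.

Definition linear_resolution (d : nat) J : Prop :=
  forall (i : nat) (j : int), j != d%:Z -> tor_vanishes J i (i%:Z + j).

Definition componentwise_linear I : Prop :=
  graded_ideal I /\
  forall d : nat, linear_resolution d (degree_component_ideal I d).

Definition K_ideal (t : nat) : R -> Prop := fun f =>
  forall i j : 'I_n, (i < j)%N ->
    ideal_pow (ideal_gen (fun g : R => g = 'X_i \/ g = 'X_j)) t f.

End Graded.

Arguments K_ideal : clear implicits.

(* Main.v *)
Require Import Defs.
From mathcomp Require Import all_boot all_order all_algebra.
From mathcomp.multinomials Require Import mpoly.
From mathcomp Require Import zify.
From Stdlib Require Import IndefiniteDescription.

(** The ideal <x_i, x_j>^t consists of the polynomials all of whose monomials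
    x^a satisfy a_i + a_j >= t, so K = K_n^(t) is the monomial ideal of the
    exponents a all of whose pairs of entries have sum at least t
    ([K_idealE]).  The ideal generated by the degree-d part of K is thus
    generated by the monomials of degree d in K, and the theorem follows from
    two facts.

    First, these monomials can be listed with linear quotients
    ([exchange_K_monomials]): for u in the list, the ideal of the f with f x^u
    in the ideal of the earlier monomials is generated by variables.  For
    monomials this is an exchange property ([pairs_ge_exchange]): if v comes
    before u, then for some l with u_l < v_l there is an i such that
    x_l x^u / x_i lies in K and also comes before u.  The list is ordered by
    decreasing min (u_1, ..., u_n, ceil(t/2)), ties being broken
    lexicographically.  If the minimum m of u is below t/2, it is attained at
    only one index p, and the other entries are at least t - m.  If v_p > m,
    moving one unit from a large entry to p raises the minimum, unless no entry
    is large enough, and then moving a suitable one yields v itself.  Otherwise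
    the minima of u and v are tied, and moving one unit from an entry that exceeds that of v
    to the first index where v is larger stays in K and increases u
    lexicographically.

    Second, an ideal generated in degree d with linear quotients has a linear
    resolution ([linear_quotients_linear_resolution]).  The notion makes sense
    for a list of vectors in a free module, that is, for the rows of a matrix,
    and then it passes to syzygies ([linear_quotients_syzygies]).  Suppose
    the colon ideal of a row g with respect to the earlier rows is generated by
    the variables x_l, l in S.  Each such l gives a syzygy with entry x_l at g
    and otherwise supported on the earlier rows; for all rows g together, these
    generate the syzygies of the matrix; and the colon ideal of such a syzygy with respect to
    the ones before it is again generated by variables, namely those treated
    before x_l, because a variable is a nonzerodivisor modulo the ideal
    generated by other variables.  When the rows are homogeneous of one degree,
    the syzygies have linear entries, so that iterating yields a resolution all
    of whose maps are linear. *)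

Set Implicit Arguments.
Unset Strict Implicit.
Unset Printing Implicit Defensive.

Import Order.TTheory GRing.Theory.

(** * The exchange property of the exponents *)

Section Exchange.
Variables (n t : nat).
Implicit Types (u v w : 'X_{1..n}) (i j l p q : 'I_n).

Definition pairs_ge u : bool :=
  [forall i : 'I_n, forall j : 'I_n, (i < j) ==> (t <= u i + u j)].

Lemma pairs_geP u :
  reflect (forall i j, i != j -> t <= u i + u j) (pairs_ge u).
Proof.
apply: (iffP idP) => [/forallP H i j ij|H].
  have [lt|lt|e] := ltngtP i j; last by rewrite (val_inj e) eqxx in ij.
    by have /forallP/(_ j)/implyP := H i; apply.
  by rewrite addnC; have /forallP/(_ i)/implyP := H j; apply.
apply/forallP => i; apply/forallP => j; apply/implyP => ij.
by apply: H; rewrite -val_eqE /= ltn_eqF.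
Qed.

(** The cap at ceil(t/2) makes all exponents with every entry at least t/2 tie:
    among these the lexicographic order alone has the exchange property. *)
Definition capped_min u : nat := \big[Order.min/uphalf t]_(i < n) u i.

Lemma capped_minP c u :
  reflect (c <= uphalf t /\ forall i, c <= u i) (c <= capped_min u).
Proof.
apply: (iffP (bigmin_geP (uphalf t) c predT (fun i => u i))) => -[c0 ci];
  by split=> // i; apply: ci.
Qed.

Lemma capped_min_attained u :
  capped_min u < uphalf t -> exists p, u p = capped_min u.
Proof.
move=> lt; have [_ le] := capped_minP _ _ (leqnn (capped_min u)).
have [/existsP[p up]|] := boolP [exists p, u p <= capped_min u].
  by exists p; apply/eqP; rewrite eqn_leq up le.
rewrite negb_exists => /forallP H.
have : (capped_min u).+1 <= capped_min u.
  by apply/capped_minP; split=> // i; rewrite ltnNge.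
by rewrite ltnn.
Qed.

(** Exponents of one degree are compared lexicographically by [<=%O].  The
    relation is weak, so as to be a total order; it puts the last generator at
    the head of a sorted list. *)
Definition listed_after u v : bool :=
  (capped_min u < capped_min v) || ((capped_min u == capped_min v) && (u <= v)%O).

Lemma listed_after_total : total listed_after.
Proof.
move=> u v; rewrite /listed_after.
by case: ltngtP => //= _; apply: le_total.
Qed.

Lemma listed_after_trans : transitive listed_after.
Proof.
move=> v u w /orP[uv|/andP[/eqP uv luv]] /orP[vw|/andP[/eqP vw lvw]]; apply/orP.
- by left; apply: ltn_trans vw.
- by left; rewrite -vw.
- by left; rewrite uv.
- by right; rewrite uv vw eqxx (le_trans luv lvw).
Qed.

Lemma listed_after_anti : antisymmetric listed_after.
Proof.
move=> u v /andP[]; rewrite /listed_after.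
by case: ltngtP => //= _ uv vu; apply/eqP; rewrite eq_le uv vu.
Qed.

Lemma lepm_mdeg_eq u v : (u <= v)%MM -> mdeg u = mdeg v -> u = v.
Proof.
move=> uv deg; have : mdeg (v - u + u) = mdeg v by rewrite submK.
rewrite mdegD deg -[RHS]add0n => /addIn/eqP; rewrite mdeg_eq0 => /eqP e.
by rewrite -(submK uv) e add0m.
Qed.

Lemma lt_coord_ex u v p : mdeg u = mdeg v -> u p < v p -> exists q, v q < u q.
Proof.
move=> deg up; apply/existsP; apply: contraTT up; rewrite negb_exists -leqNgt.
move=> /forallP H; have uv : (u <= v)%MM by apply/mnm_lepP => i; rewrite leqNgt.
by rewrite (lepm_mdeg_eq uv deg).
Qed.

Definition shift u l q : 'X_{1..n} := (u + U_(l) - U_(q))%MM.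

Lemma shiftE u l q i : shift u l q i = u i + (l == i) - (q == i).
Proof. by rewrite mnmBE mnmDE !mnm1E. Qed.

Lemma shift_le u l q : (shift u l q <= u + U_(l))%MM.
Proof. exact: lem_subr. Qed.

Lemma mdeg_shift u l q : 0 < u q -> mdeg (shift u l q) = mdeg u.
Proof.
move=> uq; have : mdeg (shift u l q + U_(q)) = mdeg (u + U_(l)).
  by rewrite submK //; apply/mnm_lepP => i; rewrite mnm1E mnmDE; case: eqP => // <-; lia.
by rewrite !mdegD !mdeg1; lia.
Qed.

(** Either u attains a minimum below t/2 at an index p where v is larger, and
    then l = p; or the capped minima of u and v agree, and then l is the first
    index where u and v differ. *)
Lemma pairs_ge_exchange u v :
  pairs_ge u -> pairs_ge v -> mdeg v = mdeg u -> v != u -> listed_after u v ->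
  exists2 l, u l < v l & exists2 w, [/\ pairs_ge w, mdeg w = mdeg u & w != u] &
    listed_after u w /\ (w <= u + U_(l))%MM.
Proof.
move=> /pairs_geP gu /pairs_geP gv deg vu uv.
have le_min : capped_min u <= capped_min v.
  by case/orP: uv => [/ltnW//|/andP[/eqP-> _]].
have [mh mu] := capped_minP _ _ (leqnn (capped_min u)).
have [_ mv] := capped_minP _ _ le_min.
have ge_min w := capped_minP (capped_min u) w.
have gt_min w := capped_minP (capped_min u).+1 w.
set m := capped_min u in mh mu mv le_min ge_min gt_min.
suff [l ul [q [lq uq gw aw]]] : exists2 l, u l < v l &
    exists q, [/\ l != q, 0 < u q, pairs_ge (shift u l q) & listed_after u (shift u l q)].
  exists l => //; exists (shift u l q); split=> //; last exact: shift_le.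
    exact: mdeg_shift.
  apply/eqP => /mnmP/(_ l); rewrite shiftE eqxx [q == l]eq_sym (negPf lq); lia.
have [/existsP[p /and3P[/eqP up pv mlt]]|] :=
  boolP [exists p, [&& u p == m, u p < v p & m < uphalf t]].
  have t2 : m.*2 < t by lia.
  have gup j : p != j -> t <= m + u j by move=> pj; rewrite -up; apply: gu.
  exists p => //.
  (* Entries other than p are at least t - m >= m + 1.  One that is at least
     m + 2 can give a unit to p, and then all entries exceed m. *)
  have [/existsP[q /andP[pq uq]]|] := boolP [exists q, (p != q) && (m.+1 < u q)].
    have wp : shift u p q p = m.+1 by rewrite shiftE eqxx eq_sym (negPf pq) up; lia.
    have wq : shift u p q q = (u q).-1 by rewrite shiftE eqxx (negPf pq); lia.
    have wj j : p != j -> q != j -> shift u p q j = u j.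
      by move=> /negPf pj /negPf qj; rewrite shiftE pj qj; lia.
    have := gup q pq => guq.
    exists q; split=> //; first lia.
      apply/pairs_geP => i j ij; have [ip|pi] := eqVneq p i; first rewrite -ip in ij *.
        rewrite wp; have [<-|qj] := eqVneq q j; first by rewrite wq; lia.
        by rewrite wj //; have := gup j ij; lia.
      have := gup i pi; have [<-|pj gi] := eqVneq p j.
        rewrite wp; have [<-|qi] := eqVneq q i; first by rewrite wq; lia.
        by rewrite wj //; lia.
      have := gup j pj; have [qi|qi] := eqVneq q i; last first.
        rewrite (wj i) //; have [<-|qj] := eqVneq q j; first by rewrite wq; lia.
        by rewrite wj //; lia.
      by rewrite -qi in ij gi *; rewrite wq wj //; lia.
    apply/orP; left; apply/gt_min; split=> // i.
    have [<-|pi] := eqVneq p i; first by rewrite wp.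
    have [<-|qi] := eqVneq q i; first by rewrite wq; lia.
    by rewrite wj //; have := gup i pi; lia.
  (* Here t = 2m + 1 and all entries of u other than p equal m + 1.  As v has
     the same degree, its minimum is at least m and any two of its entries add
     up to at least 2m + 1, it is u with one unit moved to p. *)
  rewrite negb_exists => /forallP Hp.
  have ule j : p != j -> u j = m.+1.
    by move=> pj; have := Hp j; have := gup j pj; rewrite pj /=; lia.
  have [q vq] := lt_coord_ex (esym deg) pv.
  have pq : p != q by apply: contraTneq vq => <-; rewrite -leqNgt ltnW.
  have vqm : v q = m by have := mv q; have := ule q pq; lia.
  have e : shift u p q = v.
    have dw : mdeg (shift u p q) = mdeg v by rewrite mdeg_shift //; lia.
    apply: lepm_mdeg_eq dw; apply/mnm_lepP => j; rewrite shiftE.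
    have [<-|qj] := eqVneq q j; first by rewrite (negPf pq) (ule q pq) vqm; lia.
    have [<-|pj] := eqVneq p j; first lia.
    by have := gv q j qj; have := gup q pq; have := ule q pq; have := ule j pj; lia.
  by exists q; rewrite e; split=> //; [lia|apply/pairs_geP].
rewrite negb_exists => /forallP Hp.
(* A larger minimum of v would make v larger at the index where u attains m. *)
have eqm : capped_min v = m.
  apply/eqP; rewrite eqn_leq le_min andbT leqNgt; apply/negP => lt.
  have [vh mv'] := capped_minP _ _ lt.
  have [p up] := capped_min_attained vh.
  by have := Hp p; rewrite up -/m eqxx vh (mv' p).
have ltuv : (u < v)%O.
  by move: uv; rewrite /listed_after eqm ltnn eqxx /= lt_neqAle eq_sym vu.
have [l eqv ul] := ltmcP (esym deg) ltuv.
have [q vq] := lt_coord_ex (esym deg) ul.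
have lq : l < q.
  by rewrite ltnNge leq_eqVlt; apply/negP => /orP[/eqP/val_inj e|/eqv]; [subst q|]; lia.
have lqN : l != q by rewrite -val_eqE /= ltn_eqF.
have uq : 0 < u q by lia.
have wl : shift u l q l = (u l).+1 by rewrite shiftE eqxx eq_sym (negPf lqN); lia.
have wq : shift u l q q = (u q).-1 by rewrite shiftE eqxx (negPf lqN); lia.
have wj j : l != j -> q != j -> shift u l q j = u j.
  by move=> /negPf pj /negPf qj; rewrite shiftE pj qj; lia.
(* A lower bound common to u and v survives, as the entry q that decreases
   was above that of v. *)
have wge c j : c <= u j -> c <= v j -> c <= shift u l q j.
  have [<-|lj] := eqVneq l j; first by rewrite wl; lia.
  have [<-|qj] := eqVneq q j; first by rewrite wq; lia.
  by rewrite wj.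
exists l => //; exists q; split=> //.
  have [hm|hm] := ltnP m (uphalf t).
    have [p up] := capped_min_attained hm.
    have vp : v p = m.
      have := Hp p; have := mv p; rewrite up -/m eqxx hm andbT /= -leqNgt; lia.
    have lp : l != p by apply: contraTneq ul => ->; lia.
    have qp : q != p by apply: contraTneq vq => ->; lia.
    have wp : shift u l q p = m by rewrite wj.
    have gj j : p != j -> t <= m + shift u l q j.
      move=> pj; have := wge (t - m)%N j; have := gu p j pj; have := gv p j pj; lia.
    apply/pairs_geP => i j ij; have [e|pi] := eqVneq p i.
      by rewrite -e wp gj // e.
    have [e|pj] := eqVneq p j; first by rewrite addnC -e wp gj.
    have := gj i pi; have := gj j pj; lia.
  apply/pairs_geP => i j _.
  have := wge m i (mu i) (mv i); have := wge m j (mu j) (mv j); lia.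
apply/orP; have : m <= capped_min (shift u l q) by apply/ge_min; split=> // i; apply: wge.
rewrite leq_eqVlt => /orP[e|lt]; [right|by left].
rewrite e /=; apply/ltW/ltmcP; first by rewrite mdeg_shift.
exists l; last by rewrite wl.
move=> j jl; rewrite wj // -val_eqE /= gtn_eqF //; exact: ltn_trans lq.
Qed.

End Exchange.

Local Open Scope ring_scope.

(** * Generated ideals and monomial ideals *)

Section GeneratedIdeals.
Variable A : comNzRingType.
Implicit Types (S I : A -> Prop).

Lemma is_ideal_gen S : is_ideal (ideal_gen S).
Proof.
split.
- by exists 0%N, (fun=> 0), (fun=> 0); split; [case|rewrite big_ord0].
- move=> _ _ [p [a [g [Sg ->]]]] [q [b [h [Sh ->]]]].
  exists (p + q)%N, (fun i => match split i with inl i => a i | inr i => b i end),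
    (fun i => match split i with inl i => g i | inr i => h i end).
  split=> [i|]; first by case: split.
  by rewrite big_split_ord; congr (_ + _); apply: eq_bigr => i _;
    rewrite -?[lshift _ _]/(unsplit (inl _)) -?[rshift _ _]/(unsplit (inr _)) unsplitK.
move=> f _ [p [a [g [Sg ->]]]]; exists p, (fun i => f * a i), g; split=> //.
by rewrite mulr_sumr; apply: eq_bigr => i _; rewrite mulrA.
Qed.

Lemma mem_ideal_gen S g : S g -> ideal_gen S g.
Proof.
by move=> Sg; exists 1%N, (fun=> 1), (fun=> g); rewrite big_ord1 mul1r.
Qed.

Lemma ideal_gen_min S I f : is_ideal I ->
  (forall g, S g -> I g) -> ideal_gen S f -> I f.
Proof.
move=> [I0 ID IM] SI [p [a [g [Sg ->]]]].
by apply: big_ind => // i _; apply/IM/SI.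
Qed.

Lemma is_ideal_pow I t : is_ideal (ideal_pow I t).
Proof. by case: t => [|t]; [split|exact: is_ideal_gen]. Qed.

End GeneratedIdeals.

Section MonomialIdeals.
Variables (k : fieldType) (n : nat).
Local Notation R := {mpoly k[n]}.
Implicit Types (s : seq 'X_{1..n}) (f h : R) (I : R -> Prop).

Lemma is_ideal_supp (P : pred 'X_{1..n}) :
  (forall m m', P m -> P (m' + m)%MM) -> is_ideal (fun f : R => all P (msupp f)).
Proof.
move=> upP; split=> [|f h /allP Hf /allP Hh|f h /allP Hh]; first by rewrite msupp0.
  apply/allP => m /msuppD_le.
  by rewrite mem_cat => /orP[/Hf|/Hh].
by apply/allP => m /msuppM_le /allpairsP[[a b] /= [_ /Hh Pb ->]]; apply: upP.
Qed.

Lemma ideal_of_monomials I f : is_ideal I ->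
  (forall m, m \in msupp f -> I 'X_[m]) -> I f.
Proof.
move=> [I0 ID IM] If; rewrite (mpolyE f) big_seq.
by apply: big_ind => // m /If; rewrite -mul_mpolyC; apply: IM.
Qed.

(** Membership in the ideal generated by the monomials x^a, a in s, as it can be
    read off the support. *)
Definition mono_ideal s f : bool :=
  all (fun m => has (fun a => (a <= m)%MM) s) (msupp f).

Lemma mono_idealP s f :
  reflect (forall m, m \in msupp f -> exists2 a, a \in s & (a <= m)%MM)
          (mono_ideal s f).
Proof.
apply: (iffP allP) => H m /H => [/hasP[a sa am]|[a sa am]]; first by exists a.
by apply/hasP; exists a.
Qed.

Lemma is_ideal_mono s : is_ideal (mono_ideal s).
Proof.
apply: is_ideal_supp => m m' /hasP[a sa am]; apply/hasP; exists a => //.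
by apply: (lepm_trans am); apply: lem_addl.
Qed.

Lemma mono_ideal0 s : mono_ideal s 0.
Proof. by case: (is_ideal_mono s). Qed.

Lemma mono_idealD s f h : mono_ideal s f -> mono_ideal s h -> mono_ideal s (f + h).
Proof. by case: (is_ideal_mono s) => _ + _; apply. Qed.

Lemma mono_idealM s f h : mono_ideal s h -> mono_ideal s (f * h).
Proof. by case: (is_ideal_mono s) => _ _; apply. Qed.

Lemma mono_idealX s a m : a \in s -> (a <= m)%MM -> mono_ideal s 'X_[m].
Proof.
by move=> sa am; apply/mono_idealP => m'; rewrite msuppX inE => /eqP->; exists a.
Qed.

Lemma mono_ideal_nil f : mono_ideal [::] f -> f = 0.
Proof.
move=> /allP H; apply: msuppnil0; case: (msupp f) H => // m l /(_ m).
by rewrite inE eqxx => /(_ isT).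
Qed.

Lemma mono_ideal_sub I s f : is_ideal I ->
  (forall a, a \in s -> I 'X_[a]) -> mono_ideal s f -> I f.
Proof.
move=> idI Is /mono_idealP Hf; apply: (ideal_of_monomials idI) => m /Hf[a sa am].
by case: idI => _ _ IM; rewrite -(submK am) mpolyXD; apply/IM/Is.
Qed.

(** For adding one generator x^a at a time, a variable in the construction of
    syzygies and a monomial of K in that of its degree-d part. *)
Lemma mono_ideal_cons a s f : mono_ideal (a :: s) f ->
  exists h, mono_ideal s (f - h * 'X_[a]).
Proof.
pose I f := exists h, mono_ideal s (f - h * 'X_[a]).
apply: (mono_ideal_sub (I := I)) => [|b]; first split.
- by exists 0; rewrite mul0r subr0 mono_ideal0.
- move=> f1 f2 [h1 H1] [h2 H2]; exists (h1 + h2).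
  by rewrite mulrDl opprD addrACA mono_idealD.
- move=> f1 f2 [h2 H2]; exists (f1 * h2); rewrite -mulrA -mulrBr.
  exact: mono_idealM.
rewrite inE => /orP[/eqP->|sb]; first by exists 1; rewrite mul1r subrr mono_ideal0.
by exists 0; rewrite mul0r subr0 (mono_idealX sb) ?lepm_refl.
Qed.

Lemma mono_ideal_weaken a s f : mono_ideal s f -> mono_ideal (a :: s) f.
Proof.
by apply: sub_all => m /= ->; rewrite orbT.
Qed.

Definition var_ideal (S : seq 'I_n) f := mono_ideal [seq U_(l)%MM | l <- S] f.

Lemma var_idealP (S : seq 'I_n) f :
  reflect (forall m, m \in msupp f -> exists2 l, l \in S & (0 < m l)%N)
          (var_ideal S f).
Proof.
apply: (iffP (mono_idealP _ _)) => H m /H.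
  case=> _ /mapP[l lS ->] lm; exists l => //.
  by move/mnm_lepP/(_ l): lm; rewrite mnm1E eqxx.
case=> l lS lm; exists U_(l)%MM; first exact: map_f.
by apply/mnm_lepP => i; rewrite mnm1E; case: eqP => [<-|].
Qed.

Lemma var_idealX l S f : l \in S -> var_ideal S (f * 'X_l).
Proof.
move=> lS; apply/mono_idealM/mono_idealX; last exact: lepm_refl.
exact: map_f.
Qed.

(** A variable is a nonzerodivisor modulo the ideal of other variables. *)
Lemma var_ideal_prime_to l S f :
  l \notin S -> var_ideal S (f * 'X_l) -> var_ideal S f.
Proof.
move=> lS /var_idealP H; apply/var_idealP => m fm.
have [|l' l'S] := H (U_(l) + m)%MM.
  by rewrite (perm_mem (msuppMX _ _)); apply: map_f.
rewrite mnmDE mnm1E; case: eqP => [e|_ ?]; last by exists l'.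
by rewrite e l'S in lS.
Qed.

End MonomialIdeals.

(** * Homogeneous components and matrices *)

Section Homogeneous.
Variables (k : fieldType) (n : nat).
Local Notation R := {mpoly k[n]}.

Lemma pihomogM_homog (f g : R) i e : g \is e.-homog for mdeg ->
  pihomog mdeg (i + e) (f * g) = pihomog mdeg i f * g.
Proof.
move=> ge; rewrite {1}[f]mpolyE mulr_suml raddf_sum /= [pihomog mdeg i f]pihomogE mulr_suml.
rewrite [RHS]big_mkcond /=; apply: eq_bigr => m _.
have hm : f@_m *: 'X_[m] * g \is (mdeg m + e).-homog.
  by apply: dhomogM => //; apply/dhomogZ; rewrite dhomogX.
case: eqP hm => [->|ne hm]; first by move=> hm; rewrite pihomog_dE.
by apply: pihomog_ne0 hm; rewrite eqn_add2r; apply/eqP.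
Qed.

Definition homog_mx e p q (A : 'M[R]_(p, q)) : Prop :=
  forall a b, A a b \is e.-homog for mdeg.

Lemma homog_row_mx e p q1 q2 (A : 'M_(p, q1)) (B : 'M_(p, q2)) :
  homog_mx e A -> homog_mx e B -> homog_mx e (row_mx A B).
Proof. by move=> hA hB a b; rewrite mxE; case: split. Qed.

Lemma homog_col_mx e p1 p2 q (A : 'M_(p1, q)) (B : 'M_(p2, q)) :
  homog_mx e (col_mx A B) <-> homog_mx e A /\ homog_mx e B.
Proof.
split=> [h|[hA hB] a b]; last by rewrite mxE; case: split.
by split=> a b; [rewrite -(col_mxEu A B)|rewrite -(col_mxEd A B)].
Qed.

End Homogeneous.

(** * Linear quotients pass to syzygies *)

Section LinearQuotients.
Variables (k : fieldType) (n : nat).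
Local Notation R := {mpoly k[n]}.

Definition in_span p q (G : 'M[R]_(p, q)) (g : 'rV_q) : Prop :=
  exists v : 'rV_p, g = v *m G.

Lemma in_span_col_mx p q (G : 'M_(p, q)) g h :
  in_span (col_mx G g) h <-> exists c, in_span G (h - c *: g).
Proof.
split=> [[v ->]|[c [v e]]].
  exists (rsubmx v 0 0), (lsubmx v).
  rewrite -{1}(hsubmxK v) mul_row_col {1}[rsubmx v]mx11_scalar mul_scalar_mx.
  by rewrite addrK.
by exists (row_mx v c%:M); rewrite mul_row_col mul_scalar_mx -e subrK.
Qed.

Lemma dhomog_var (l : 'I_n) : ('X_l : R) \is 1.-homog for mdeg.
Proof. by rewrite dhomogX; apply/eqP/mdeg1. Qed.

(** The linear components of any coefficients of x_l g still express it, the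
    degrees of g and of the rows of G being equal. *)
Lemma homog_in_span e p q (G : 'M_(p, q)) (l : 'I_n) g :
  homog_mx e G -> homog_mx e g -> in_span G ('X_l *: g) ->
  exists2 v : 'rV_p, homog_mx 1 v & 'X_l *: g = v *m G.
Proof.
move=> hG hg [v ev]; exists (map_mx (pihomog mdeg 1) v).
  by move=> a b; rewrite mxE; apply: pihomogP.
apply/rowP => b; have := congr1 (fun A : 'rV_q => pihomog mdeg (1 + e) (A 0 b)) ev.
rewrite !mxE pihomogM_homog ?hg // pihomog_dE ?dhomog_var // => ->.
rewrite raddf_sum /=; apply: eq_bigr => a _.
by rewrite mxE pihomogM_homog ?hG.
Qed.

(** The last two hypotheses of [LinearQuotientsD] say together that the colon
    ideal of g by the span of G is generated by the variables x_l, l in S. *)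
Inductive linear_quotients q : forall p, 'M[R]_(p, q) -> Prop :=
| LinearQuotients0 (G : 'M_(0, q)) : linear_quotients G
| LinearQuotientsD p (G : 'M_(p, q)) (g : 'rV_q) (S : seq 'I_n) :
    linear_quotients G -> uniq S ->
    (forall l, l \in S -> in_span G ('X_l *: g)) ->
    (forall f, in_span G (f *: g) -> var_ideal S f) ->
    linear_quotients (col_mx G g).

(** Colon ideals are preserved by an injective map of free modules; it is
    applied to the inclusion of a free module as the first summand. *)
Lemma linear_quotients_mulmxr p q q' (G : 'M_(p, q)) (P : 'M_(q, q')) :
  (forall v : 'rV_q, v *m P = 0 -> v = 0) ->
  linear_quotients G -> linear_quotients (G *m P).
Proof.
move=> injP; elim=> [{}G|{}p {}G g S _ IH uS HS Hf].
  exact: LinearQuotients0.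
rewrite mul_col_mx; apply: (LinearQuotientsD (S := S)) => //.
  by move=> l /HS[v e]; exists v; rewrite scalemxAl e mulmxA.
move=> f [v e]; apply: Hf; exists v; apply: subr0_eq; apply: injP.
by rewrite mulmxBl -scalemxAl e mulmxA subrr.
Qed.

(** Induction on the rows of G.  For a new row g, the syzygies of G extended by
    zero are followed by one syzygy for each variable of the colon ideal S of g.
    Adding the latter one at a time, the rows obtained for T inside S span
    exactly the syzygies whose entry at g lies in the ideal of the variables
    of T; for T = S these are all the syzygies.  This description of the span
    also gives the colon ideal of each row that is added. *)
Lemma linear_quotients_syzygies e p q (G : 'M_(p, q)) :
  linear_quotients G -> homog_mx e G ->
  exists p' (D : 'M_(p', p)),
    [/\ linear_quotients D, homog_mx 1 D &
        forall v, in_span D v <-> v *m G = 0].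
Proof.
elim=> [{}G _|{}p {}G g S _ IH uS HS Hf /homog_col_mx[hG hg]].
  exists 0%N, 0; split=> [||v]; [exact: LinearQuotients0|by case|].
  by split=> _; [rewrite [v]thinmx0 mul0mx|exists 0; apply/rowP; case].
have {IH} [p' [D [lqD hD spanD]]] := IH hG.
have {Hf} colon v f : v *m G + f *: g = 0 -> var_ideal S f.
  move=> e0; apply: Hf; exists (- v); apply/eqP.
  by rewrite mulNmx -addr_eq0 addrC e0.
suff build T : {subset T <= S} -> uniq T ->
    exists p1 (D1 : 'M_(p1, p + 1)), [/\ linear_quotients D1, homog_mx 1 D1 &
      forall v f, in_span D1 (row_mx v f%:M) <->
                  v *m G + f *: g = 0 /\ var_ideal T f].
  have [//|p1 [D1 [lq1 h1 sp1]]] := build S _ uS.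
  exists p1, D1; split=> // w.
  rewrite -[w]hsubmxK [rsubmx w]mx11_scalar mul_row_col mul_scalar_mx sp1.
  by split=> [[]|H] //; split=> //; apply: colon H.
elim: T => [_ _|l T IH /allP /= /andP[lS /allP TS] /andP[lT uT]].
  exists p', (D *m row_mx 1%:M 0); split.
  - apply: linear_quotients_mulmxr lqD => v.
    by rewrite mul_mx_row mulmx1 -[RHS]row_mx0 => /eq_row_mx[].
  - rewrite mul_mx_row mulmx1 mulmx0; apply: homog_row_mx => // a b.
    by rewrite mxE dhomog0.
  move=> v f; split=> [[u]|[ev /mono_ideal_nil f0]].
    rewrite !mul_mx_row mulmx1 !mulmx0 => /eq_row_mx[-> /matrixP/(_ 0 0)].
    rewrite !mxE eqxx mulr1n => ->; rewrite scale0r addr0; split.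
      by apply/spanD; exists u.
    exact: mono_ideal0.
  rewrite f0 scale0r addr0 in ev; have /spanD[u ->] := ev.
  by exists u; rewrite f0 !mul_mx_row mulmx1 !mulmx0 raddf0.
have [p1 [D1 [lq1 h1 sp1]]] := IH TS uT.
have [c hc ec] := homog_in_span hG hg (HS l lS).
exists (p1 + 1)%N, (col_mx D1 (row_mx (- c) ('X_l)%:M)); split.
- apply: (LinearQuotientsD (S := T)) => // [l' l'T|f].
    rewrite scale_row_mx scale_scalar_mx; apply/sp1; split.
      by rewrite -scalemxAl mulNmx -ec scalerN scalerA addNr.
    by rewrite mulrC; apply: var_idealX.
  by rewrite scale_row_mx scale_scalar_mx => /sp1[_ /var_ideal_prime_to]; apply.
- apply/homog_col_mx; split=> //; apply: homog_row_mx => a b.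
    by rewrite mxE rpredN; apply: hc.
  by rewrite mxE !ord1 mulr1n dhomog_var.
move=> v f; rewrite in_span_col_mx.
have E h : row_mx v f%:M - h *: row_mx (- c) ('X_l)%:M
    = row_mx (v + h *: c) (f - h * 'X_l)%:M.
  by rewrite scale_row_mx opp_row_mx add_row_mx scale_scalar_mx scalerN opprK raddfB.
have E' h : (v + h *: c) *m G + (f - h * 'X_l) *: g = v *m G + f *: g.
  by rewrite mulmxDl -scalemxAl -ec scalerBl scalerA addrACA subrr addr0.
split=> [[h]|[syz /mono_ideal_cons[h Tf]]].
  rewrite E => /sp1; rewrite E' => -[-> Tf]; split=> //.
  rewrite -[f](subrK (h * 'X_l)); apply: mono_idealD.
    exact: mono_ideal_weaken.
  by apply: var_idealX; rewrite inE eqxx.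
by exists h; rewrite E; apply/sp1; rewrite E'.
Qed.

End LinearQuotients.

(** * The linear resolution *)

Section Resolution.
Variables (k : fieldType) (n : nat).
Local Notation R := {mpoly k[n]}.

(** One map of the resolution, with the properties that allow its syzygies to be
    taken again. *)
Record stage := Stage {
  stage_cols : nat;
  stage_rows : nat;
  stage_deg : nat;
  stage_mx : 'M[R]_(stage_rows, stage_cols);
  stage_lq : linear_quotients stage_mx;
  stage_homog : homog_mx stage_deg stage_mx
}.

Lemma next_stage_exists (s : stage) :
  exists D : {p' & 'M[R]_(p', stage_rows s)},
    [/\ linear_quotients (tagged D), homog_mx 1 (tagged D) &
        forall v, in_span (tagged D) v <-> v *m stage_mx s = 0].
Proof.
have [p' [D hD]] := linear_quotients_syzygies (@stage_lq s) (@stage_homog s).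
by exists (existT _ p' D).
Qed.

Definition next_syz s := constructive_indefinite_description _ (next_stage_exists s).

Lemma next_syzP s :
  let D := proj1_sig (next_syz s) in
  [/\ linear_quotients (tagged D), homog_mx 1 (tagged D) &
      forall v, in_span (tagged D) v <-> v *m stage_mx s = 0].
Proof. by rewrite /=; case: (next_syz s). Qed.

Lemma next_lq s : linear_quotients (tagged (proj1_sig (next_syz s))).
Proof. by case: (next_syzP s). Qed.

Lemma next_homog s : homog_mx 1 (tagged (proj1_sig (next_syz s))).
Proof. by case: (next_syzP s). Qed.

(** The columns of the next map are indexed by the rows of s by computation, so
    that iterating gives composable matrices without casts. *)
Definition next_stage (s : stage) : stage := Stage (next_lq s) (@next_homog s).

Lemma next_stageP s (v : 'rV_(stage_rows s)) :
  v *m stage_mx s = 0 <-> in_span (stage_mx (next_stage s)) v.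
Proof. by have [_ _ H] := next_syzP s; rewrite -H. Qed.

Section FromStage.
Variables (d p : nat) (G : 'M[R]_(p, 1)).
Hypotheses (lqG : linear_quotients G) (hG : homog_mx d G).

Let st i := iter i next_stage (Stage lqG hG).

Definition lq_complex : augmented_complex k n :=
  @AugmentedComplex k n (fun i => stage_rows (st i)) (fun i _ => (d + i)%:Z)
    (fun i => stage_mx (next_stage (st i))) G.

Lemma homog_of_degP e (f : R) : f \is e.-homog for mdeg -> homog_of_deg e%:Z f.
Proof. by move=> /dhomogP H m /H ->. Qed.

Lemma lq_complex_resolution (J : R -> Prop) :
  (forall f, J f <-> in_span G f%:M) -> graded_free_resolution lq_complex J.
Proof.
move=> HJ; split=> [i a b|a|f|v|i v].
- rewrite /= (_ : _ - _ = 1%:Z); last lia.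
  exact/homog_of_degP/(@stage_homog (next_stage (st i))).
- by rewrite /= addn0; apply: homog_of_degP.
- rewrite HJ; split=> -[v e]; exists v; first by rewrite -e mxE eqxx.
  by rewrite [RHS]mx11_scalar e.
- exact: (next_stageP (s := st 0)).
- exact: (next_stageP (s := st i.+1)).
Qed.

End FromStage.

(** The i-th term of the resolution is generated in degree d + i only, so a
    vector in another degree of its tensor product with k is zero, and hence a
    boundary. *)
Theorem linear_quotients_linear_resolution d p (G : 'M[R]_(p, 1)) (J : R -> Prop) :
  linear_quotients G -> homog_mx d G -> (forall f, J f <-> in_span G f%:M) ->
  linear_resolution d J.
Proof.
move=> lqG hG HJ i j jd; exists (lq_complex lqG hG).
  exact: lq_complex_resolution.
move=> v Hv _; exists 0; rewrite mul0mx; apply/rowP => a; rewrite mxE.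
apply: Hv; rewrite /=; lia.
Qed.

End Resolution.

(** * Monomials with linear quotients *)

Section MonomialLinearQuotients.
Variables (k : fieldType) (n : nat).
Local Notation R := {mpoly k[n]}.
Implicit Types (s : seq 'X_{1..n}).

(** The list is read from its end: the generators that come before the head u
    are those of the tail. *)
Fixpoint exchange_seq s : Prop :=
  if s is u :: s' then
    (forall v, v \in s' -> exists2 l, (u l < v l)%N &
       exists2 w, w \in s' & (w <= u + U_(l))%MM) /\ exchange_seq s'
  else True.

(** If x^m x^u is divisible by an earlier x^v and u_l < v_l, then x_l divides
    x^m; and the exchange puts x_l in the colon ideal of x^u.  So this ideal is
    generated by the variables x_l such that x_l x^u is divisible by an earlier
    monomial. *)
Lemma exchange_seq_linear_quotients d s :
  exchange_seq s -> (forall a, a \in s -> mdeg a = d) ->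
  exists p (G : 'M[R]_(p, 1)), [/\ linear_quotients G, homog_mx d G &
    forall f, in_span G f%:M <-> mono_ideal s f].
Proof.
elim: s => [|u s IH] /=.
  move=> _ _; exists 0%N, 0; split=> [||f]; [exact: LinearQuotients0|by case|].
  split=> [[v]|/mono_ideal_nil ->]; last by exists 0; rewrite mul0mx raddf0.
  by rewrite mulmx0 => /matrixP/(_ 0 0); rewrite !mxE eqxx mulr1n => ->; apply: mono_ideal0.
move=> [exch_u /IH{}IH] deg_us.
have [|p [G [lqG hG spanG]]] := IH.
  by move=> a sa; apply: deg_us; rewrite inE sa orbT.
have scaleE h : h *: ('X_[u])%:M = (h * 'X_[u])%:M :> 'M[R]_1 by rewrite scale_scalar_mx.
pose S := [seq l <- enum 'I_n | has (fun w => (w <= u + U_(l))%MM) s].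
exists (p + 1)%N, (col_mx G ('X_[u])%:M); split.
- apply: (LinearQuotientsD (S := S)) => // [|l|f].
  + exact/filter_uniq/enum_uniq.
  + rewrite mem_filter => /andP[/hasP[w sw wl] _].
    by rewrite scaleE spanG -mpolyXD addmC; apply: mono_idealX sw wl.
  rewrite scaleE spanG => /mono_idealP Hf; apply/var_idealP => m fm.
  have [|v sv vm] := Hf (u + m)%MM.
    by rewrite (perm_mem (msuppMX _ _)); apply: map_f.
  have [l ul [w sw wl]] := exch_u v sv; exists l.
    by rewrite mem_filter mem_enum andbT; apply/hasP; exists w.
  by move/mnm_lepP/(_ l): vm; rewrite mnmDE; lia.
- apply/homog_col_mx; split=> // a b.
  by rewrite mxE !ord1 mulr1n dhomogX; apply/eqP/deg_us; rewrite inE eqxx.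
move=> f; rewrite in_span_col_mx.
have E h : f%:M - h *: ('X_[u])%:M = (f - h * 'X_[u])%:M :> 'M[R]_1.
  by rewrite scaleE raddfB.
split=> [[h]|/mono_ideal_cons[h Hh]]; last by exists h; rewrite E spanG.
rewrite E spanG => Hh; rewrite -[f](subrK (h * 'X_[u])).
apply: mono_idealD; first exact: mono_ideal_weaken.
apply/mono_idealM/mono_idealX; last exact: lepm_refl.
by rewrite inE eqxx.
Qed.

End MonomialLinearQuotients.

(** * The ideal K and its graded components *)

Section KIdeal.
Variables (k : fieldType) (n t : nat).
Local Notation R := {mpoly k[n]}.
Implicit Types (f : R) (m : 'X_{1..n}).

Definition edge_ideal (i j : 'I_n) : R -> Prop :=
  ideal_gen (fun g => g = 'X_i \/ g = 'X_j).

Lemma is_ideal_edge_supp e (i j : 'I_n) :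
  is_ideal (fun f : R => all (fun m : 'X_{1..n} => e <= m i + m j)%N (msupp f)).
Proof. by apply: is_ideal_supp => m m'; rewrite !mnmDE; lia. Qed.

(** A monomial whose exponents at i and j sum to at least e > 0 is divisible by
    x_i or x_j, and the quotient satisfies the condition for e - 1.  For i = j
    the right-hand side would count the exponent twice. *)
Lemma edge_ideal_powE e (i j : 'I_n) f : i != j ->
  ideal_pow (edge_ideal i j) e f <->
  all (fun m : 'X_{1..n} => e <= m i + m j)%N (msupp f).
Proof.
move=> ij; split=> [|Hf].
  elim: e f => [|e IH] f; first by move=> _; apply/allP => m _.
  apply: (ideal_gen_min (is_ideal_edge_supp e.+1 i j)).
  move=> _ [a [b [Ea /IH/allP Hb ->]]].
  have {Ea} /allP Ha : all (fun m : 'X_{1..n} => 1 <= m i + m j)%N (msupp a).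
    apply: (ideal_gen_min (is_ideal_edge_supp 1 i j)) Ea.
    by move=> _ [] ->; rewrite msuppX /= !mnm1E eqxx; lia.
  apply/allP => m /msuppM_le /allpairsP[[m1 m2] /= [/Ha h1 /Hb h2 ->]].
  by rewrite !mnmDE; lia.
apply: ideal_of_monomials; first exact: is_ideal_pow.
move=> m /(allP Hf) {Hf}; elim: e m => [|e IH] m //= le.
have step (l : 'I_n) : l = i \/ l = j -> (0 < m l)%N ->
    ideal_pow (edge_ideal i j) e.+1 'X_[m].
  move=> lij ml; apply: mem_ideal_gen; exists 'X_l, 'X_[(m - U_(l))%MM]; split.
  - by apply: mem_ideal_gen; case: lij => ->; [left|right].
  - apply: IH; rewrite !mnmBE !mnm1E.
    by case: lij ml => -> ml; rewrite eqxx ?[j == i]eq_sym (negPf ij); lia.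
  rewrite -mpolyXD addmC submK //.
  by apply/mnm_lepP => p; rewrite mnm1E; case: eqP => [<-|].
have [mi|mi] := posnP (m i); last by apply: (step i) => //; left.
by apply: (step j); [right|lia].
Qed.

Lemma K_idealE f : K_ideal k n t f <-> all (pairs_ge t) (msupp f).
Proof.
have neq (i j : 'I_n) : (i < j)%N -> i != j by move=> ij; rewrite -val_eqE /= ltn_eqF.
split=> [Kf|/allP Hf i j ij].
  apply/allP => m fm; apply/forallP => i; apply/forallP => j; apply/implyP => ij.
  by have /(edge_ideal_powE _ _ (neq _ _ ij))/allP := Kf i j ij; apply.
apply/(edge_ideal_powE _ _ (neq _ _ ij))/allP => m /Hf.
by move=> /forallP/(_ i)/forallP/(_ j)/implyP; apply.
Qed.

Lemma is_ideal_pairs_ge : is_ideal (fun f : R => all (pairs_ge t) (msupp f)).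
Proof.
apply: is_ideal_supp => m m' /pairs_geP gm; apply/pairs_geP => i j /gm.
by rewrite !mnmDE; lia.
Qed.

Lemma graded_K_ideal : graded_ideal (K_ideal k n t).
Proof.
have [I0 ID IM] := is_ideal_pairs_ge.
have idK : is_ideal (K_ideal k n t).
  split=> [|f g /K_idealE Hf /K_idealE Hg|f g /K_idealE Hg]; apply/K_idealE => //.
    exact: ID.
  exact: IM.
split=> // f d /K_idealE/allP Hf; apply/K_idealE.
rewrite pihomogE big_seq_cond.
apply: (big_ind (fun f : R => all (pairs_ge t) (msupp f))) => // m /andP[fm _].
by rewrite -mul_mpolyC; apply: IM; rewrite msuppX /= Hf.
Qed.

Definition K_monomials d : seq 'X_{1..n} :=
  sort (listed_after t)
    [seq m <- [seq bmnm x | x <- enum {: 'X_{1..n < d.+1}}]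
       | (mdeg m == d) && pairs_ge t m].

Lemma mem_K_monomials d m :
  (m \in K_monomials d) = (mdeg m == d) && pairs_ge t m.
Proof.
rewrite mem_sort mem_filter andb_idr // => /andP[/eqP md _].
have lt : (mdeg m < d.+1)%N by rewrite md.
by apply/mapP; exists (BMultinom lt); rewrite ?mem_enum.
Qed.

Lemma degree_component_K_ideal d f :
  degree_component_ideal (K_ideal k n t) d f <-> mono_ideal (K_monomials d) f.
Proof.
rewrite /degree_component_ideal; split.
  apply: (ideal_gen_min (is_ideal_mono k _)).
  move=> g [/K_idealE/allP Kg /dhomogP dg]; apply/mono_idealP => m gm.
  by exists m; rewrite ?lepm_refl // mem_K_monomials dg ?eqxx ?Kg.
apply: mono_ideal_sub; first exact: is_ideal_gen.
move=> m; rewrite mem_K_monomials => /andP[/eqP md gm].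
apply: mem_ideal_gen; split; last by rewrite dhomogX; apply/eqP.
by apply/K_idealE; rewrite msuppX /= gm.
Qed.

(** Induction over the tails of the sorted list.  The invariant is that a tail
    contains every monomial of K of degree d listed before one of its members,
    so that the monomial produced by the exchange lies in the tail. *)
Lemma exchange_K_monomials d : exchange_seq (K_monomials d).
Proof.
have closed u w : u \in K_monomials d -> pairs_ge t w -> mdeg w = mdeg u ->
    listed_after t u w -> w \in K_monomials d.
  by rewrite !mem_K_monomials => /andP[/eqP <- _] -> -> _; rewrite eqxx.
have good u : u \in K_monomials d -> mdeg u = d /\ pairs_ge t u.
  by rewrite mem_K_monomials => /andP[/eqP].
have := sort_sorted (@listed_after_total n t) _ : sorted _ (K_monomials d).
have : uniq (K_monomials d).
  by rewrite sort_uniq filter_uniq // map_inj_uniq ?enum_uniq //; apply: val_inj.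
elim: (K_monomials d) closed good => //= u s IH closed good /andP[us uns] sorted_us.
have after_u v : v \in s -> listed_after t u v.
  move: sorted_us; rewrite (path_sortedE (@listed_after_trans n t)).
  by move=> /andP[/allP H _]; apply: H.
have [du gu] := good u (mem_head _ _).
split=> [v sv|]; last first.
  apply: IH => // [b w sb gw dw bw|b sb|]; last exact: path_sorted sorted_us.
  - have : w \in u :: s by apply: closed gw dw bw; rewrite inE sb orbT.
    rewrite inE => /orP[/eqP e|//]; subst w.
    have e : b = u by apply: (@listed_after_anti n t); rewrite bw after_u.
    by rewrite -e sb in us.
  - by apply: good; rewrite inE sb orbT.
have [dv gv] : mdeg v = d /\ pairs_ge t v by apply: good; rewrite inE sv orbT.
have vu : v != u by apply: contraNneq us => <-.
have [|l ul [w [gw dw wu] [uw wl]]] := pairs_ge_exchange gu gv _ vu (after_u v sv).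
  by rewrite dv du.
exists l => //; exists w => //.
by have := closed u w (mem_head _ _) gw dw uw; rewrite inE (negPf wu).
Qed.

End KIdeal.

Theorem theorem2p3 (k : fieldType) (n t : nat) (hn : (3 <= n)%N)
    (ht : (1 <= t)%N) :
  componentwise_linear (K_ideal k n t).
Proof.
split=> [|d]; first exact: graded_K_ideal.
have [|p [G [lqG hG spanG]]] :=
  exchange_seq_linear_quotients k (exchange_K_monomials n t d) (d := d).
  by move=> a; rewrite mem_K_monomials => /andP[/eqP].
apply: linear_quotients_linear_resolution lqG hG _ => f.
by rewrite degree_component_K_ideal spanG.
Qed.
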